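(* Let $\mathbb{V}$ be an $n$-dimensional vector space ($n\ge 1$) over a finite field $\mathbb{F}$ with $q$ elements, with basis $\{\alpha_1,\ldots,\alpha_n\}$. Then the edge connectivity of the non-zero component graph $\Gamma(\mathbb{V})$ with respect to this basis is $q^{n-1}(q-1)-1$.
   Context: Let $\theta$ be the null vector of $\mathbb{V}$. Every $\mathbf{a}\in\mathbb{V}$ is written uniquely as $\mathbf{a}=a_1\alpha_1+\cdots+a_n\alpha_n$. The non-zero component graph $\Gamma(\mathbb{V})$ with respect to the basis $\{\alpha_1,\ldots,\alpha_n\}$ is the simple graph with vertex set $\mathbb{V}\setminus\{\theta\}$ in which two distinct vertices $\mathbf{a},\mathbf{b}$ are adjacent if and only if there is at least one $i$ such that the coefficients of $\alpha_i$ in $\mathbf{a}$ and in $\mathbf{b}$ are both non-zero. The edge connectivity of a graph is the minimum number of edges whose removal disconnects it (by convention $0$ for a graph with a single vertex). *)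

(* Defs.v *)
From HB Require Import structures.
From mathcomp Require Import all_boot all_algebra all_field.

Set Implicit Arguments.
Unset Strict Implicit.
Unset Printing Implicit Defensive.

Import GRing.Theory.

Local Open Scope ring_scope.

Record sgraph := SGraph {
  vertex :> finType;
  adj : rel vertex;
  adj_sym : symmetric adj;
  adj_irrefl : irreflexive adj
}.

Section EdgeConnectivity.
Variable G : sgraph.

Definition edges : {set {set G}} :=
  [set [set p.1; p.2] | p : G * G & adj p.1 p.2].

Definition remove_edges (S : {set {set G}}) : rel G :=
  [rel x y | adj x y && ([set x; y] \notin S)].

Definition disconnects (S : {set {set G}}) : bool :=
  (S \subset edges) && ~~ [forall x, forall y, connect (remove_edges S) x y].

(* The [arg min] default [edges] is never a junk value here: see
   [edges_disconnects]. *)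
Definition edge_connectivity : nat :=
  if (#|G| <= 1)%N then 0%N
  else #|[arg min_(S < edges | disconnects S) #|S|]|.

Lemma edges_disconnects : (1 < #|G|)%N -> disconnects edges.
Proof.
case/card_gt1P=> x [y [_ _ neq_xy]]; rewrite /disconnects subxx /=.
apply/negP=> /forallP/(_ x)/forallP/(_ y)/connectP[[|z p] /=].
  by move=> _ eq_yx; rewrite eq_yx eqxx in neq_xy.
case/andP=> /andP[xz /negP nxz] _ _; apply: nxz.
by apply/imsetP; exists (x, z); rewrite ?inE.
Qed.

End EdgeConnectivity.

Section NonZeroComponentGraph.
Variables (F : finFieldType) (V : vectType F) (n : nat) (alpha : n.-tuple V).

(* [finvect_type V] is [V] itself, with its canonical finite type structure
   over the finite field [F]. *)
Definition nonzero_vector : finType := {v : finvect_type V | v != 0}.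

Definition nzc_adj : rel nonzero_vector :=
  fun a b => (a != b) &&
    [exists i : 'I_n, (coord alpha i (val a) != 0) &&
                      (coord alpha i (val b) != 0)].

Lemma nzc_adj_sym : symmetric nzc_adj.
Proof.
move=> a b; rewrite /nzc_adj eq_sym; congr andb.
by apply: eq_existsb => i; rewrite andbC.
Qed.

Lemma nzc_adj_irrefl : irreflexive nzc_adj.
Proof. by move=> a; rewrite /nzc_adj eqxx. Qed.

Definition nonzero_component_graph : sgraph :=
  SGraph nzc_adj_sym nzc_adj_irrefl.

End NonZeroComponentGraph.

(* Main.v *)
Require Import Defs.
From HB Require Import structures.
From mathcomp Require Import all_boot all_algebra all_field.

(** In a graph of diameter at most two the edge connectivity is the minimum
    degree (Plesnik's theorem, [edge_connectivity_diameter_two]).  If there are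
    at least two vertices, the edges at a vertex of minimum degree form a
    disconnecting set.  Conversely, a disconnecting set contains all the edges
    between some proper nonempty set of vertices and its complement, and these
    are at least as numerous as the neighbours of a suitable vertex on one of
    the two sides ([exists_degree_le_cut]).  On a single vertex both the degree
    and the edge connectivity are zero.

    The graph of nonzero components has diameter at most two, because the sum
    of the basis vectors has full support and so is adjacent to all the other
    vertices.  Its minimum degree is attained at the basis vectors: a vertex
    with nonzero [i]-th coordinate is adjacent to all the other vectors with
    nonzero [i]-th coordinate, and a basis vector has no other neighbours.
    There are [q ^ (n - 1) * (q - 1)] vectors whose [i]-th coordinate is
    nonzero, and the vertex itself is one of them. *)

Set Implicit Arguments.
Unset Strict Implicit.
Unset Printing Implicit Defensive.

Import GRing.Theory.

Section DiameterTwo.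
Variable G : sgraph.
Implicit Types (x y a v : G) (A : {set G}) (S : {set {set G}}).

Definition neighbours x : {set G} := [set y | adj x y].

Definition cut_edges_in A S :=
  forall x y, x \in A -> y \notin A -> adj x y -> [set x; y] \in S.

Lemma cut_edges_inC A S : cut_edges_in A S -> cut_edges_in (~: A) S.
Proof.
move=> cutAS x y; rewrite !inE negbK => xA yA xy.
by rewrite setUC; apply: cutAS => //; rewrite adj_sym.
Qed.

(** Neighbours of [a] are sent injectively to cut edges: a neighbour outside
    [A] to the edge joining it to [a], and a neighbour [c] in [A] to an edge
    from [c] to the complement of [A]. *)
Lemma degree_le_cut A S a :
    cut_edges_in A S -> a \in A ->
    (forall x, x \in A -> exists2 y, y \notin A & adj x y) ->
  #|neighbours a| <= #|S|.
Proof.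
move=> cutAS aA exitA.
pose exit x := odflt x [pick y | (y \notin A) && adj x y].
have exitP x : x \in A -> (exit x \notin A) && adj x (exit x).
  move=> xA; rewrite /exit; case: pickP => //= noexit.
  by have [y yA xy] := exitA x xA; have := noexit y; rewrite yA xy.
pose g c := if c \in A then [set c; exit c] else [set a; c].
(* The edge [g c] determines [c]: its end in [A] is [c] when [c] is in [A] and
   [a] otherwise, and in the latter case its other end is [c]. *)
have gIA c : g c :&: A = [set if c \in A then c else a].
  rewrite /g; case: ifP => cA; apply/setP=> z; rewrite !inE.
    have /andP[eA _] := exitP c cA.
    case: (z =P c) => [->|_] //=.
    by case: eqP => [->|_] //=; rewrite (negbTE eA).
  case: (z =P a) => [->|_] /=; first by rewrite aA.
  by case: eqP => [->|_] //=.
have gDA c : c \notin A -> g c :\: A = [set c].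
  move=> cA; rewrite /g (negbTE cA); apply/setP=> z; rewrite !inE.
  case: (z =P c) => [->|_]; first by rewrite orbT cA.
  by rewrite orbF; case: eqP => [->|_]; rewrite ?aA ?andbF.
have g_inj : {in neighbours a &, injective g}.
  move=> c d; rewrite !inE => ac ad gcd.
  have nea e : adj a e -> a != e.
    by move=> ae; apply: contraTneq ae => <-; rewrite adj_irrefl.
  have := gIA c; rewrite gcd gIA => /set1_inj.
  have [cA|cA] := boolP (c \in A); have [dA|dA] := boolP (d \in A) => //.
  - by move=> eac; have := nea c ac; rewrite eac eqxx.
  - by move=> eda; have := nea d ad; rewrite eda eqxx.
  - by move=> _; apply: set1_inj; rewrite -(gDA c cA) -(gDA d dA) gcd.
rewrite -(card_in_imset g_inj); apply/subset_leq_card/subsetP=> e.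
case/imsetP=> c; rewrite inE => ac ->; rewrite /g; case: ifPn => cA.
  by have /andP[? ?] := exitP c cA; apply: cutAS.
exact: cutAS.
Qed.

Definition diameter_le2 :=
  forall x y, [|| x == y, adj x y | [exists z, adj x z && adj z y]].

(** If some vertex of [A] has all its neighbours in [A], then the middle vertex
    of a path of length two from it to a vertex outside [A] lies in [A].  So on
    one of the two sides every vertex has a neighbour on the other side. *)
Lemma exists_degree_le_cut A S x y :
    diameter_le2 -> cut_edges_in A S -> x \in A -> y \notin A ->
  exists a, #|neighbours a| <= #|S|.
Proof.
move=> diam2 cutAS xA yA.
have [/forall_inP exitA|] :=
    boolP [forall (z | z \in A), [exists w, (w \notin A) && adj z w]].
  exists x; apply: degree_le_cut cutAS xA _ => z /exitA/existsP[w /andP[]].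
  by exists w.
case/forall_inPn=> z zA /existsPn noexit.
have stay w : adj z w -> w \in A.
  by move=> zw; have := noexit w; rewrite zw andbT negbK.
exists y; apply: degree_le_cut (cut_edges_inC cutAS) _ _; first by rewrite inE.
move=> w; rewrite inE => wA; case/or3P: (diam2 z w).
- by move=> /eqP ezw; rewrite -ezw zA in wA.
- by move/stay=> w_in_A; rewrite w_in_A in wA.
- case/existsP=> u /andP[/stay uA uw]; exists u; first by rewrite inE negbK.
  by rewrite adj_sym.
Qed.

(** The set is the component of [x] once the edges of [S] are removed. *)
Lemma disconnects_cut S : disconnects S ->
  exists A, exists x, exists y, [/\ x \in A, y \notin A & cut_edges_in A S].
Proof.
case/andP=> _ /forallPn[x /forallPn[y nxy]].
exists [set z | connect (remove_edges S) x z], x, y.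
split; rewrite ?inE ?connect0 // => z w; rewrite !inE => xz nxw zw.
apply: contraR nxw => zwS.
by apply/(connect_trans xz)/connect1; rewrite /remove_edges /= zw.
Qed.

Definition star x : {set {set G}} := [set [set x; y] | y in neighbours x].

Lemma star_disconnects x : 1 < #|G| -> disconnects (star x).
Proof.
move=> G_gt1; apply/andP; split.
  apply/subsetP=> e /imsetP[y]; rewrite inE => xy ->.
  by apply/imsetP; exists (x, y); rewrite ?inE.
have [y neq_yx] : exists y, y != x.
  case/card_gt1P: G_gt1 => y [z [_ _ neq_yz]].
  have [eyx|] := eqVneq y x; last by exists y.
  by exists z; rewrite -eyx eq_sym.
apply/forallPn; exists x; apply/forallPn; exists y.
apply/connectP=> -[[|z p] /=].
  by move=> _ eyx; rewrite eyx eqxx in neq_yx.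
case/andP=> /andP[xz /negP nxz] _ _; apply: nxz.
by apply/imsetP; exists z; rewrite ?inE.
Qed.

Theorem edge_connectivity_diameter_two v :
    diameter_le2 -> (forall x, #|neighbours v| <= #|neighbours x|) ->
  edge_connectivity G = #|neighbours v|.
Proof.
move=> diam2 vmin; rewrite /edge_connectivity; case: leqP => [G_le1|G_gt1].
  apply/esym/eqP; rewrite cards_eq0 -subset0; apply/subsetP=> y; rewrite inE.
  have -> : y = v by apply: (fintype_le1P G_le1).
  by rewrite adj_irrefl.
case: arg_minnP => [|S Sdisc Smin]; first exact: edges_disconnects.
apply/eqP; rewrite eqn_leq; apply/andP; split.
  exact: leq_trans (Smin _ (star_disconnects v G_gt1)) (leq_imset_card _ _).
have [A [x [y [xA yA cutAS]]]] := disconnects_cut Sdisc.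
have [a leaS] := exists_degree_le_cut diam2 cutAS xA yA.
exact: leq_trans (vmin a) leaS.
Qed.

End DiameterTwo.

Local Open Scope ring_scope.

Section NonZeroComponents.
Variables (F : finFieldType) (V : vectType F) (n : nat) (alpha : n.-tuple V).
Hypothesis alpha_basis : basis_of {:V} alpha.

Let alpha_free : free alpha := basis_free alpha_basis.

Lemma coord_eq0 (v : V) : (forall i, coord alpha i v = 0) -> v = 0.
Proof.
move=> v0; rewrite (coord_basis alpha_basis (memvf v)).
by apply: big1 => i _; rewrite v0 scale0r.
Qed.

Lemma nonzero_coord (a : nonzero_vector V) :
  exists i, coord alpha i (val a) != 0.
Proof.
apply/existsP; apply: contraNT (valP a) => /existsPn a0.
by apply/eqP/coord_eq0 => i; apply/eqP; rewrite -[_ == _]negbK a0.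
Qed.

(** Coordinates identify these vectors with the functions on ['I_n] whose value
    at [i] is nonzero; the vector is then nonzero too. *)
Lemma card_coord_neq0 (i : 'I_n) :
  #|[set v : nonzero_vector V | coord alpha i (val v) != 0]|
    = (#|F| ^ (n - 1) * (#|F| - 1))%N.
Proof.
pose P j := if j == i then predC1 (0 : F) else predT.
pose coords (v : nonzero_vector V) := [ffun j => coord alpha j (val v)].
have coords_inj : injective coords.
  move=> v w /ffunP vw; apply: val_inj; apply/eqP; rewrite -subr_eq0.
  apply/eqP/(@coord_eq0 (val v - val w : V)) => j.
  have := vw j; rewrite !ffunE => vwj.
  by apply/eqP; rewrite linearB subr_eq0; apply/eqP.
rewrite -(card_imset _ coords_inj).
transitivity #|family P|.
  apply: eq_card => f; apply/imsetP/familyP => [[v] | fP].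
    rewrite inE => vi -> j; rewrite ffunE /P.
    by case: eqP => [->|_]; rewrite !inE.
  pose v : V := \sum_j f j *: alpha`_j.
  have vE j : coord alpha j v = f j by rewrite coord_sum_free.
  have fi : f i != 0 by have := fP i; rewrite /P eqxx !inE.
  have v0 : (v : finvect_type V) != 0.
    by apply: contraNneq fi => v0; rewrite -vE v0 linear0.
  exists (Sub v v0); rewrite ?inE ?SubK ?vE //.
  by apply/ffunP=> j; rewrite ffunE SubK vE.
rewrite card_family foldrE big_map big_enum /= (bigD1 i) //= /P eqxx.
rewrite cardC1 !subn1 mulnC; congr (_ * _)%N.
rewrite (eq_bigr (fun=> #|F|)) => [|j /negbTE->]; last exact: eq_card.
by rewrite prod_nat_const cardC1 card_ord.
Qed.

Let Gamma := nonzero_component_graph alpha.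

Lemma coord_neq0_adj (a : Gamma) (i : 'I_n) : coord alpha i (val a) != 0 ->
  [set v : nonzero_vector V | coord alpha i (val v) != 0] :\ a
    \subset neighbours a.
Proof.
move=> ai; apply/subsetP=> b; rewrite !inE => /andP[neq_ba bi].
by rewrite /adj /= /nzc_adj eq_sym neq_ba; apply/existsP; exists i; rewrite ai.
Qed.

Lemma degree_ge (a : Gamma) :
  (#|F| ^ (n - 1) * (#|F| - 1) - 1 <= #|neighbours a|)%N.
Proof.
have [i ai] := nonzero_coord a.
apply: leq_trans (subset_leq_card (coord_neq0_adj ai)).
by rewrite -(card_coord_neq0 i) (cardsD1 a) inE ai addKn.
Qed.

Lemma basis_vector_neq0 (i : 'I_n) : (alpha`_i : finvect_type V) != 0.
Proof.
apply: contraTneq (oner_neq0 F) => ai0.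
have := coord_free i i alpha_free; rewrite eqxx ai0 linear0 mulr1n => <-.
by rewrite eqxx.
Qed.

Definition basis_vertex (i : 'I_n) : Gamma :=
  exist (fun v : finvect_type V => v != 0) _ (basis_vector_neq0 i).

Lemma degree_basis_vertex (i : 'I_n) :
  #|neighbours (basis_vertex i)| = (#|F| ^ (n - 1) * (#|F| - 1) - 1)%N.
Proof.
have coordE j : coord alpha j (val (basis_vertex i)) = (i == j)%:R.
  exact: coord_free.
apply/eqP; rewrite eqn_leq degree_ge andbT -(card_coord_neq0 i).
set A := [set v | _]; have vA : basis_vertex i \in A.
  by rewrite inE coordE eqxx oner_neq0.
rewrite (cardsD1 (basis_vertex i) A) vA addKn.
apply/subset_leq_card/subsetP=> b; rewrite in_setD1 !inE.
case/andP=> neq_vb /existsP[j /andP[vj bj]]; rewrite eq_sym neq_vb /=.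
have [-> //|neq_ij] := eqVneq i j.
by move: vj; rewrite coordE (negbTE neq_ij) eqxx.
Qed.

(** The sum of the basis vectors, which has full support, is the middle vertex,
    unless it is one of the two ends and then these are adjacent. *)
Lemma nonzero_component_graph_diameter : diameter_le2 Gamma.
Proof.
move=> x y; have [//|neq_xy] := eqVneq x y.
have [i xi] := nonzero_coord x; have [j yj] := nonzero_coord y.
pose u : V := \sum_(k < n) 1 *: alpha`_k.
have uE k : coord alpha k u = 1 by rewrite (coord_sum_free (fun=> 1)).
have u0 : (u : finvect_type V) != 0.
  by apply: contraTneq (oner_neq0 F) => u0; rewrite -(uE i) u0 linear0 eqxx.
pose z : Gamma := exist (fun v : finvect_type V => v != 0) _ u0.
have adj_z (w : Gamma) : z != w -> adj z w.
  move=> neq_zw; have [k wk] := nonzero_coord w.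
  apply/andP; split=> //; apply/existsP; exists k.
  by rewrite wk uE oner_neq0.
have [ezx|neq_zx] := eqVneq z x; first by rewrite -ezx adj_z ?ezx.
have [ezy|neq_zy] := eqVneq z y.
  by rewrite -ezy adj_sym adj_z // eq_sym.
by apply/or3P/Or33/existsP; exists z; rewrite adj_sym !adj_z.
Qed.

End NonZeroComponents.

Theorem corollary3p2 (F : finFieldType) (q : nat) (hq : #|F| = q)
    (V : vectType F) (n : nat) (hn : (1 <= n)%N) (hV : \dim {:V} = n)
    (alpha : n.-tuple V) (halpha : basis_of {:V} alpha) :
  edge_connectivity (nonzero_component_graph alpha) =
    (q ^ (n - 1) * (q - 1) - 1)%N.
Proof.
rewrite -hq -(degree_basis_vertex halpha (Ordinal hn)).
apply: edge_connectivity_diameter_two => [|x].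
  exact: nonzero_component_graph_diameter.
by rewrite degree_basis_vertex degree_ge.
Qed.
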